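(* Let $\Bbbk$ be a field of characteristic $0$, let $\Delta$ be a simplicial complex on $n$ vertices, let $G(\Delta)$ be the $1$-skeleton of $\Delta$, and let $A=A(\Delta)=\Bbbk[x_1,\ldots,x_n]/\langle x_1^2,\ldots,x_n^2, I_\Delta\rangle$, where $I_\Delta$ is the Stanley-Reisner ideal of $\Delta$. (i) If $\dim_\Bbbk A_2\ge \dim_\Bbbk A_1$, then the Weak Lefschetz Property (WLP) holds for $A$ in degree $1$ if and only if $G(\Delta)$ has no bipartite connected components. (ii) If $\dim_\Bbbk A_2<\dim_\Bbbk A_1$, then WLP holds for $A$ in degree $1$ if and only if each bipartite connected component of $G(\Delta)$ (if any exists) is a tree and, in each non-bipartite connected component of $G(\Delta)$, the number of edges equals the number of vertices. Further, in this case ($\dim_\Bbbk A_2<\dim_\Bbbk A_1$), if WLP holds in degree $1$ then WLP holds in all degrees.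
   Context: A simplicial complex $\Delta$ on a finite non-empty vertex set $V=\{1,\ldots,n\}$ is a non-empty collection of subsets (faces) of $V$ closed under taking subsets; a face with $k+1$ elements is a $k$-face. Its Stanley-Reisner ideal is $I_\Delta=\langle x_{i_1}\cdots x_{i_m} : \{i_1,\ldots,i_m\}\notin\Delta\rangle\subseteq \Bbbk[x_1,\ldots,x_n]$. The algebra $A(\Delta)$ is standard graded and Artinian; $A_i$ denotes its degree-$i$ component. The $1$-skeleton $G(\Delta)$ is the graph whose vertices are the $0$-faces and whose edges are the $1$-faces of $\Delta$. (An isolated vertex is a bipartite component and a tree.) WLP holds for $A$ in degree $i$ if, for a general linear form $\ell$, the multiplication map $\times\ell: A_i\to A_{i+1}$ has maximal rank, i.e. is injective or surjective. WLP holds in all degrees if it holds in degree $i$ for all $i$. *)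

(* Defs.v *)
From HB Require Import structures.
From mathcomp Require Import all_boot all_order all_algebra.
From mathcomp Require Import boolp.
From mathcomp Require Import freeg mpoly.

Set Implicit Arguments.
Unset Strict Implicit.
Unset Printing Implicit Defensive.

Import GRing.Theory.
Local Open Scope ring_scope.
Local Open Scope quotient_scope.

(* The relation e is meant to be symmetric and irreflexive. *)

Section Graphs.
Context {T : finType}.
Implicit Types (e : rel T) (C : {set T}).

Definition components e : {set {set T}} :=
  equivalence_partition (connect e) [set: T].

Definition induced e C : rel T := [rel u v | [&& u \in C, v \in C & e u v]].

Definition edges_in e C : {set {set T}} :=
  [set [set u; v] | u in C, v in C & e u v].

Definition bipartite_on e C : bool :=
  [exists X : {set T}, forall u, forall v,
     induced e C u v ==> ((u \in X) != (v \in X))].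

Definition connected_on e C : bool :=
  (C != set0) && [forall u in C, forall v in C, connect (induced e C) u v].

(* A closed walk u, v, u of length 2 satisfies ucycle; the cycles of a simple
   graph are the duplicate-free closed walks of length at least 3. *)
Definition acyclic_on e C : Prop :=
  forall c : seq T, ucycle (induced e C) c -> (size c <= 2)%N.

Definition tree_on e C : Prop := connected_on e C /\ acyclic_on e C.

End Graphs.

(* Elements of 'I_n need not be 0-faces. *)
Record scomplex (n : nat) := SComplex {
  faces :> {set {set 'I_n}};
  faces_neq0 : faces != set0;
  faces_closed :
    forall s t : {set 'I_n}, t \subset s -> s \in faces -> t \in faces
}.

Section Skeleton.
Context {n : nat}.
Variable D : scomplex n.

Definition vertex : predArgType := {i : 'I_n | [set i] \in faces D}.

Definition skel1 : rel vertex :=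
  [rel u v | (val u != val v) && ([set val u; val v] \in faces D)].

Lemma skel1_sym : ssrbool.symmetric skel1.
Proof. by move=> u v; rewrite /skel1 /= eq_sym setUC. Qed.

Lemma skel1_irr : irreflexive skel1.
Proof. by move=> u; rewrite /skel1 /= eqxx. Qed.

End Skeleton.
Arguments skel1 {n} D _ _.

Definition ideal_gen (R : comNzRingType) (S : R -> Prop) (p : R) : Prop :=
  exists s : seq (R * R),
    (forall cg, cg \in s -> S cg.2) /\ p = \sum_(cg <- s) cg.1 * cg.2.

Section IdealGen.
Context {R : comNzRingType}.
Implicit Types (S : R -> Prop) (p q a : R).

Lemma ideal_gen0 S : ideal_gen S 0.
Proof. by exists [::]; rewrite big_nil. Qed.

Lemma ideal_genD S p q : ideal_gen S p -> ideal_gen S q -> ideal_gen S (p + q).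
Proof.
move=> [s [Ss ->]] [t [St ->]]; exists (s ++ t); rewrite big_cat; split=> //.
by move=> cg; rewrite mem_cat => /orP[/Ss|/St].
Qed.

Lemma ideal_genM S a p : ideal_gen S p -> ideal_gen S (a * p).
Proof.
move=> [s [Ss ->]]; exists [seq (a * cg.1, cg.2) | cg <- s]; split.
  by move=> _ /mapP[cg /Ss Scg ->].
by rewrite big_map big_distrr /=; apply: eq_bigr => cg _; rewrite mulrA.
Qed.

Lemma ideal_gen_sub S p : S p -> ideal_gen S p.
Proof.
move=> Sp; exists [:: (1, p)]; rewrite big_seq1 mul1r; split=> //.
by move=> cg; rewrite inE => /eqP->.
Qed.

Lemma ideal_gen_min S (J : R -> Prop) :
    J 0 -> (forall p q, J p -> J q -> J (p + q)) ->
    (forall a p, J p -> J (a * p)) -> (forall p, S p -> J p) ->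
  forall p, ideal_gen S p -> J p.
Proof.
move=> J0 JD JM JS p [s [Ss ->]]; rewrite big_seq.
by elim/big_ind: _ => // cg /Ss /JS; apply: JM.
Qed.

End IdealGen.

Section StanleyReisner.
Context (k : fieldType) (n : nat).
Variable D : scomplex n.
Implicit Types (s t : {set 'I_n}) (p q : {mpoly k[n]}).

Definition sr_ideal : {mpoly k[n]} -> Prop :=
  ideal_gen (fun p => exists2 s, s \notin faces D & p = \prod_(i in s) 'X_i).

Definition A_ideal : {mpoly k[n]} -> Prop :=
  ideal_gen (fun p => (exists i, p = 'X_i ^+ 2) \/ sr_ideal p).

Definition A_idealb : pred {mpoly k[n]} := fun p => `[< A_ideal p >].

Definition sqfree s : 'X_{1..n} := [multinom (i \in s : nat) | i < n]%MM.

Lemma sqfreeE s : 'X_[sqfree s] = \prod_(i in s) 'X_i :> {mpoly k[n]}.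
Proof.
rewrite mpolyXE_id [RHS]big_mkcond /=; apply: eq_bigr => i _.
by rewrite mnmE; case: (i \in s); rewrite ?expr1 ?expr0.
Qed.

Lemma sqfree_inj : injective sqfree.
Proof.
move=> s t /mnmP st; apply/setP => i; move: (st i); rewrite !mnmE.
by do 2 case: (_ \in _).
Qed.

Lemma sqfreeP (m : 'X_{1..n}) :
  (forall i, m i <= 1)%N -> m = sqfree [set i | m i == 1%N].
Proof.
by move=> m1; apply/mnmP => i; rewrite mnmE inE; case: (m i) (m1 i) => [|[]].
Qed.

Lemma set0_face : set0 \in faces D.
Proof.
have /set0Pn[s sD] := faces_neq0 D; exact: faces_closed (sub0set s) sD.
Qed.

(* The ideal consists of the polynomials in which no face monomial occurs. *)
Lemma A_idealP p : A_ideal p <-> {in faces D, forall s, p@_(sqfree s) = 0}.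
Proof.
pose J q := {in faces D, forall s, q@_(sqfree s) = 0}.
have J0 : J 0 by move=> s _; apply: mcoeff0.
have JD p1 p2 : J p1 -> J p2 -> J (p1 + p2).
  by move=> J1 J2 s sD; rewrite mcoeffD J1 ?J2 ?addr0.
have JM a p1 : J p1 -> J (a * p1).
  move=> J1 s sD; rewrite mcoeffM big1 // => -[m1 m2] /= /eqP/mnmP em.
  suff -> : p1@_m2 = 0 by rewrite mulr0.
  have m2s i : (m2 i <= (i \in s))%N.
    by move: (em i); rewrite mnmE mnmDE => ->; rewrite leq_addl.
  rewrite (@sqfreeP m2) => [|i]; last exact: leq_trans (m2s i) (leq_b1 _).
  apply/J1/(faces_closed _ sD)/subsetP => i; rewrite inE => /eqP m2i.
  by move: (m2s i); rewrite m2i; case: (i \in s).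
split.
  apply: (ideal_gen_min J0 JD JM) => q [[i ->] s sD|].
    rewrite mcoeffXn; case: eqP => // /mnmP/(_ i).
    by rewrite mulmnE mnm1E mnmE eqxx; case: (i \in s).
  apply: (ideal_gen_min J0 JD JM) => _ [t tD ->] s sD; rewrite -sqfreeE mcoeffX.
  by case: eqP => // /sqfree_inj ts; rewrite -ts (negPf tD) in sD.
move=> Jp; rewrite [p]mpolyE big_seq; elim/big_ind: _ => [|q1 q2|m mp].
- exact: ideal_gen0.
- exact: ideal_genD.
rewrite -mul_mpolyC; apply: ideal_genM.
have [/forallP m1|/forallPn[i]] := boolP [forall i, m i <= 1]%N.
  rewrite (sqfreeP m1) sqfreeE; apply/ideal_gen_sub; right; apply/ideal_gen_sub.
  exists [set i | m i == 1%N] => //; apply: contraL mp => /Jp.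
  by rewrite -(sqfreeP m1) mcoeff_msupp negbK => ->.
rewrite -ltnNge => m2.
have le_m : (U_(i) *+ 2 <= m)%MM.
  apply/mnm_lepP => j; rewrite mulmnE mnm1E.
  by case: (i =P j) => [<-|].
rewrite -(submK le_m) mpolyXD; apply/ideal_genM/ideal_gen_sub; left.
by exists i; rewrite mpolyXn.
Qed.

Lemma A_idealbP p :
  reflect {in faces D, forall s, p@_(sqfree s) = 0} (p \in A_idealb).
Proof. by apply: (iffP (asboolP _)) => /A_idealP. Qed.

Lemma A_ideal_closed : idealr_closed A_idealb.
Proof.
split.
- by apply/asboolP/ideal_gen0.
- apply/negP => /A_idealbP/(_ _ set0_face)/eqP.
  rewrite mcoeff1; suff -> : sqfree set0 = 0%MM by rewrite eqxx oner_eq0.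
  by apply/mnmP => i; rewrite !mnmE inE.
- move=> a u v /asboolP Iu /asboolP Iv.
  by apply/asboolP/ideal_genD/Iv/ideal_genM.
Qed.

HB.instance Definition _ :=
  isIdealr.Build {mpoly k[n]} A_idealb A_ideal_closed.

Definition A_idealr : idealr {mpoly k[n]} := A_idealb.

Definition SRA : Type := {ideal_quot A_idealr}.

HB.instance Definition _ := GRing.ComNzRing.on SRA.

Definition piA : {mpoly k[n]} -> SRA := \pi_{ideal_quot A_idealr}.

HB.instance Definition _ := GRing.RMorphism.copy piA \pi_{ideal_quot A_idealr}.

Lemma piA_eq p q : piA p = piA q <-> A_ideal (p - q).
Proof.
split=> [/eqP|Ipq]; first by rewrite -Quotient.idealrBE => /asboolP.
by apply/eqP; rewrite -Quotient.idealrBE; apply/asboolP.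
Qed.

Lemma piA_surj (u : SRA) : exists p, u = piA p.
Proof. by exists (repr u); rewrite /piA reprK. Qed.

Definition SRA_scale (a : k) (u : SRA) : SRA := piA a%:MP * u.

Lemma SRA_scaleA a b u : SRA_scale a (SRA_scale b u) = SRA_scale (a * b) u.
Proof. by rewrite /SRA_scale mulrA -rmorphM -mpolyCM. Qed.

Lemma SRA_scale1 : left_id 1 SRA_scale.
Proof. by move=> u; rewrite /SRA_scale mpolyC1 rmorph1 mul1r. Qed.

Lemma SRA_scaleDr : right_distributive SRA_scale +%R.
Proof. by move=> a u v; rewrite /SRA_scale mulrDr. Qed.

Lemma SRA_scaleDl u : {morph SRA_scale^~ u : a b / a + b}.
Proof. by move=> a b; rewrite /SRA_scale mpolyCD rmorphD mulrDl. Qed.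

HB.instance Definition _ := GRing.Zmodule_isLmodule.Build k SRA
  SRA_scaleA SRA_scale1 SRA_scaleDr SRA_scaleDl.

Lemma SRA_scaleAl (a : k) (u v : SRA) : a *: (u * v) = (a *: u) * v.
Proof. exact: mulrA. Qed.

HB.instance Definition _ := GRing.Lmodule_isLalgebra.Build k SRA SRA_scaleAl.
HB.instance Definition _ := GRing.Lalgebra_isComAlgebra.Build k SRA.

Lemma piA_is_scalable : scalable piA.
Proof. by move=> a p; rewrite -mul_mpolyC rmorphM. Qed.

HB.instance Definition _ :=
  GRing.isScalable.Build k {mpoly k[n]} SRA *:%R piA piA_is_scalable.

(* The monomials X_[sqfree s], s a face, form a basis of A. *)
Definition SRA_coord (u : SRA) : 'rV[k]_#|faces D| :=
  \row_j (repr u)@_(sqfree (enum_val j)).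

Lemma SRA_coord_piA p j : SRA_coord (piA p) 0 j = p@_(sqfree (enum_val j)).
Proof.
rewrite mxE; apply/eqP; rewrite -subr_eq0 -mcoeffB; apply/eqP.
have /A_idealP : A_ideal (repr (piA p) - p) by apply/piA_eq; rewrite /piA reprK.
by apply; apply: enum_valP.
Qed.

Fact SRA_vect_axiom : Vector.axiom #|faces D| SRA.
Proof.
exists SRA_coord.
  move=> a u v; have [[p ->] [q ->]] := (piA_surj u, piA_surj v).
  rewrite -linearZ -linearD; apply/rowP => j.
  rewrite SRA_coord_piA mcoeffD mcoeffZ [RHS]mxE [X in _ = X + _]mxE.
  by rewrite !SRA_coord_piA.
exists (fun r : 'rV_#|faces D| => piA (\sum_j r 0 j *: 'X_[sqfree (enum_val j)])).
  move=> u; have [p ->] := piA_surj u; apply/piA_eq/A_idealP => s sD.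
  rewrite mcoeffB raddf_sum (bigD1 (enum_rank_in sD s)) //= big1 => [|j js].
    by rewrite addr0 mcoeffZ SRA_coord_piA mcoeffX enum_rankK_in // eqxx mulr1 subrr.
  rewrite mcoeffZ mcoeffX; case: eqP => [/sqfree_inj sE|_]; last by rewrite mulr0.
  by case/eqP: js; apply/enum_val_inj; rewrite sE enum_rankK_in.
move=> r; apply/rowP => j; rewrite SRA_coord_piA raddf_sum (bigD1 j) //= big1.
  by rewrite addr0 mcoeffZ mcoeffX eqxx mulr1.
move=> i ij; rewrite mcoeffZ mcoeffX; case: eqP => [/sqfree_inj/enum_val_inj ji|_].
  by rewrite ji eqxx in ij.
by rewrite mulr0.
Qed.

HB.instance Definition _ := Lmodule_hasFinDim.Build k SRA SRA_vect_axiom.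

Definition A_deg (d : nat) : {vspace SRA} :=
  (\sum_(m : 'X_{1..n < d.+1} | mdeg (val m) == d) <[piA 'X_[val m]]>)%VS.

Lemma A_degP d (u : SRA) :
  reflect (exists2 p, p \is d.-homog & u = piA p) (u \in A_deg d).
Proof.
apply: (iffP idP) => [/memv_sumP[f fP ->]|[p /dhomogP p_d ->]].
  elim/big_ind: _ => [|v w [p ? ->] [q ? ->]|m m_d].
  - by exists 0; rewrite ?rpred0 ?raddf0.
  - by exists (p + q); rewrite ?rpredD ?raddfD.
  - have /vlineP[a ->] := fP m m_d; exists (a *: 'X_[val m]); last by rewrite linearZ.
    by rewrite rpredZ // dhomogX.
rewrite [p]mpolyE linear_sum big_seq; apply: rpred_sum => m mp.
rewrite linearZ rpredZ //=; have m_d : (mdeg m < d.+1)%N by rewrite ltnS (p_d m mp).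
apply: (subvP (sumv_sup (BMultinom m_d) _ (subvv _))) (memv_line _) => /=.
by rewrite (p_d m mp).
Qed.

Definition linear_form (a : 'I_n -> k) : SRA := piA (\sum_i a i *: 'X_i).

Definition max_rank (l : SRA) (d : nat) : Prop :=
  {in A_deg d &, injective (fun u => l * u)} \/
  (forall v, v \in A_deg d.+1 -> exists2 u, u \in A_deg d & v = l * u).

(* "For a general linear form": for all linear forms whose coefficient vector
   lies in some nonempty basic Zariski-open subset of k^n. *)
Definition wlp (d : nat) : Prop :=
  exists P : {mpoly k[n]}, (exists a : 'I_n -> k, P.@[a] != 0) /\
    forall a : 'I_n -> k, P.@[a] != 0 -> max_rank (linear_form a) d.

End StanleyReisner.

(* Main.v *)
(* A_1 and A_2 have the vertices and the edges of the 1-skeleton G as bases, and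
   after rescaling the variables a general linear form becomes the sum of the
   variables, so x l : A_1 -> A_2 becomes the map sending a function u on the
   vertices to the function v w |-> u v + u w on the edges. A function in the
   kernel changes sign along each edge, so the map is injective iff no component
   of G is bipartite. For surjectivity one component C is treated at a time. If C
   is not bipartite the incidence matrix of C has independent rows, and is thus
   surjective iff it is square. If C is bipartite, the indicator of an edge is in
   the image iff that edge is a bridge. Finally, A is generated in degree 1, so
   surjectivity in degree 1 implies surjectivity in all higher degrees. *)
From HB Require Import structures.
Require Import Defs.
From mathcomp Require Import all_boot all_order all_algebra.
From mathcomp Require Import boolp.
From mathcomp Require Import mpoly.
From mathcomp Require Import ring.

Set Implicit Arguments.
Unset Strict Implicit.
Unset Printing Implicit Defensive.

Import GRing.Theory.
Local Open Scope ring_scope.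

(** * Connected components of a finite graph *)

Section Components.
Context (T : finType) (e : rel T).
Hypothesis e_sym : ssrbool.symmetric e.
Implicit Types (v w : T) (C : {set T}).

Lemma components_closed C v w :
  C \in components e -> connect e v w -> (v \in C) = (w \in C).
Proof.
move=> /imsetP[x _ ->] vw; rewrite !inE /=.
exact: same_connect_r (sym_connect_sym e_sym) _ _ vw x.
Qed.

Lemma components_edge C v w :
  C \in components e -> e v w -> (v \in C) = (w \in C).
Proof. by move=> Cc /connect1; apply: components_closed. Qed.

Lemma components_connect C v w :
  C \in components e -> v \in C -> w \in C -> connect e v w.
Proof.
move=> /imsetP[x _ ->]; rewrite !inE /= => xv; apply: connect_trans.
by rewrite (sym_connect_sym e_sym).
Qed.

Lemma mem_component v : exists2 C, C \in components e & v \in C.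
Proof.
exists [set w in [set: T] | connect e v w]; last by rewrite !inE connect0.
exact: imset_f.
Qed.

Lemma path_induced C v p :
  C \in components e -> v \in C -> path e v p -> path (induced e C) v p.
Proof.
move=> Cc; elim: p v => //= w p IHp v vC /andP[vw wp].
have wC : w \in C by rewrite -(components_edge Cc vw).
by rewrite IHp // andbT; apply/and3P.
Qed.

Lemma component_connected C : C \in components e -> connected_on e C.
Proof.
move=> Cc; apply/andP; split.
  by case/imsetP: Cc => x _ ->; apply/set0Pn; exists x; rewrite !inE connect0.
apply/'forall_in_forall_inP => v vC w wC.
have /connectP[p /(path_induced Cc vC) vp ->] := components_connect Cc vC wC.
by apply/connectP; exists p.
Qed.

(** A path from [v] to [w] avoiding the edge, once made duplicate-free, closes up with it to a
    cycle. The bound 2 on its length leaves a loop at [v] or the excluded edge itself. *)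
Lemma acyclic_bridge C v w :
    irreflexive e -> C \in components e -> acyclic_on e C -> v \in C -> e v w ->
  ~~ connect [rel x y | e x y && ([set x; y] != [set v; w])] v w.
Proof.
move=> e_irr Cc Cac vC vw; apply/negP => /connectP[p /shortenP[q vq Uq _] wE].
have: ucycle (induced e C) (v :: q).
  rewrite /ucycle Uq andbT; apply: path_induced => //.
  rewrite rcons_path -wE e_sym vw andbT.
  by apply: sub_path vq => x y /andP[].
move=> /Cac; case: q vq {Uq} wE => [|x [|//]] /=.
  by move=> _ wE; rewrite wE e_irr in vw.
by move=> + wE; rewrite -wE eqxx andbF.
Qed.

End Components.

(** * Edge sums of vertex functions and the incidence matrix *)

Section Incidence.
Context (k : fieldType) (T : finType) (e : rel T).
Hypotheses (e_sym : ssrbool.symmetric e) (e_irr : irreflexive e).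
Hypothesis char_neq2 : 2%:R != 0 :> k.
Implicit Types (u s : T -> k) (C : {set T}).

Definition edge_sum_inj : Prop :=
  forall u, (forall v w, e v w -> u v + u w = 0) -> forall v, u v = 0.

Definition edge_sum_surj : Prop :=
  forall y : {set T} -> k,
  exists u, forall v w, e v w -> u v + u w = y [set v; w].

(** The two colour classes get opposite signs; on [C] this gives a nonzero function with zero edge
    sums. *)
Lemma bipartite_sgn C : C \in components e -> bipartite_on e C ->
  exists s, (forall v, s v * s v = 1) /\
            (forall v w, v \in C -> e v w -> s w = - s v).
Proof.
move=> Cc /existsP[X /forallP Xbip]; exists (fun v => (-1) ^+ (v \in X)).
split=> [v|v w vC vw]; first by rewrite -expr2 sqrr_sign.
move: (forallP (Xbip v) w).
rewrite /induced /= vC -(components_edge e_sym Cc vw) vC vw /=.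
by case: (v \in X); case: (w \in X) => //= _; rewrite ?expr0 ?expr1 ?opprK.
Qed.

(** Along walks from [v] the function only takes the values [u v] and [- u v]. If [u v] is nonzero
    these differ, as 2 is invertible, and the vertices with value [u v] form one side of a
    bipartition. *)
Lemma nonbipartite_eq0 C u : C \in components e -> ~~ bipartite_on e C ->
    (forall v w, v \in C -> e v w -> u v + u w = 0) ->
  {in C, forall v, u v = 0}.
Proof.
move=> Cc + u_sum v vC; apply: contraNeq => uv_neq0.
have u_pm w : w \in C -> u w = u v \/ u w = - u v.
  move=> wC; have /connectP[p vp ->] := components_connect e_sym Cc vC wC.
  suff: forall x, x \in C -> path e x p -> u x = u v \/ u x = - u v ->
      u (last x p) = u v \/ u (last x p) = - u v by apply => //; left.
  elim: p {vp} => //= y p IHp x xC /andP[xy yp] ux.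
  apply: IHp yp _; first by rewrite -(components_edge e_sym Cc xy).
  have /eqP := u_sum _ _ xC xy; rewrite addrC addr_eq0 => /eqP->.
  by case: ux => ->; [right|left; rewrite opprK].
apply/existsP; exists [set w | u w == u v].
apply/forallP => x; apply/forallP => y; apply/implyP => /and3P[xC yC xy].
have uvN : u v != - u v by rewrite -addr_eq0 -mulr2n -mulr_natl mulf_neq0.
have /eqP := u_sum _ _ xC xy; rewrite addrC addr_eq0 !inE => /eqP->.
by case: (u_pm x xC) => ->; rewrite ?opprK eqxx ?(eq_sym (- u v)) (negPf uvN).
Qed.

Lemma edge_sum_injP :
  edge_sum_inj <-> forall C, C \in components e -> ~~ bipartite_on e C.
Proof.
split=> [inj C Cc|nbip u u_sum v]; last first.
  have [C Cc vC] := mem_component e v.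
  by apply: (nonbipartite_eq0 Cc (nbip C Cc)) vC => x y _; apply: u_sum.
apply/negP => /(bipartite_sgn Cc)[s [s_sq s_alt]].
have /andP[/set0Pn[v vC] _] := component_connected e_sym Cc.
(* No edge leaves [C], so the sign function extended by 0 has zero edge sums. *)
have s0 : (if v \in C then s v else 0) = 0.
  apply: (inj (fun x => if x \in C then s x else 0)) => x y xy.
  rewrite (components_edge e_sym Cc xy); case: ifP => yC; last by rewrite addr0.
  by rewrite (s_alt x y) ?subrr ?(components_edge e_sym Cc xy).
by have /eqP := s_sq v; rewrite vC in s0; rewrite s0 mul0r eq_sym oner_eq0.
Qed.

(** Rows are indexed by vertices, so a row vector times this matrix is its vector of edge sums:
    [row_free] expresses injectivity on [C] and [row_full] surjectivity. *)
Definition incidence C : 'M[k]_(#|C|, #|edges_in e C|) :=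
  \matrix_(i, j) (enum_val i \in (enum_val j : {set T}))%:R.

Lemma edges_inP C S : C \in components e ->
  reflect (exists v w, [/\ v \in C, w \in C, e v w & S = [set v; w]])
          (S \in edges_in e C).
Proof.
move=> Cc; apply: (iffP imset2P) => [[v w vC]|[v [w [vC wC vw ->]]]].
  by rewrite inE => /andP[wC vw] ->; exists v, w.
by exists v w; rewrite // inE wC.
Qed.

Lemma mul_incidence C u j v w : v \in C -> w \in C -> e v w ->
    enum_val j = [set v; w] ->
  ((\row_i u (enum_val i)) *m incidence C) 0 j = u v + u w.
Proof.
move=> vC wC vw jE; rewrite mxE.
under eq_bigr do rewrite !mxE jE.
rewrite -(big_enum_val (fun x => u x * (x \in [set v; w])%:R)) /=.
have vNw : v != w by apply: contraTneq vw => ->; rewrite e_irr.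
rewrite (bigD1 v) //= (bigD1 w) /=; last by rewrite wC eq_sym.
rewrite set21 set22 !mulr1 big1 ?addr0 // => x /andP[/andP[_ xv] xw].
by rewrite !inE (negPf xv) (negPf xw) mulr0.
Qed.

Lemma row_extend C (r : 'rV[k]_#|C|) :
  exists2 u, (forall v, v \notin C -> u v = 0) & r = \row_i u (enum_val i).
Proof.
exists (fun v => \sum_i r 0 i * (enum_val i == v)%:R) => [v vC|].
  by apply: big1 => i _; case: eqP vC => [<-|]; rewrite ?enum_valP ?mulr0.
apply/rowP => j; rewrite mxE (bigD1 j) //= eqxx mulr1 big1 ?addr0 // => i ij.
by rewrite (inj_eq enum_val_inj) (negPf ij) mulr0.
Qed.

Lemma nonbipartite_row_free C : C \in components e -> ~~ bipartite_on e C ->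
  row_free (incidence C).
Proof.
move=> Cc nbip; apply: inj_row_free => r; have [u _ ->] := row_extend r.
move=> /rowP u0; apply/rowP => i; rewrite !mxE.
apply: (nonbipartite_eq0 Cc nbip) (enum_valP i) => v w vC vw.
have wC : w \in C by rewrite -(components_edge e_sym Cc vw).
have vwE : [set v; w] \in edges_in e C by apply/edges_inP => //; exists v, w.
rewrite -(mul_incidence u (j := enum_rank_in vwE [set v; w]) vC wC vw).
  by rewrite u0 mxE.
by rewrite enum_rankK_in.
Qed.

Lemma edge_sum_surj_row_full C : C \in components e ->
  edge_sum_surj -> row_full (incidence C).
Proof.
(* Row [i] of the identity matrix is the indicator of the [i]-th edge. *)
move=> Cc surj; rewrite -sub1mx; apply/row_subP => i.
have [u uE] := surj (fun S => (S == enum_val i)%:R).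
apply/submxP; exists (\row_i u (enum_val i)); apply/rowP => j.
have /(edges_inP _ Cc)[v [w [vC wC vw jE]]] := enum_valP j.
rewrite (mul_incidence _ vC wC vw jE) uE // -jE !mxE.
by rewrite (inj_eq enum_val_inj) eq_sym.
Qed.

(* Solving for the indicator of an edge inside a cycle would make the function
   [s * u] constant along the rest of the cycle. *)
Lemma edge_sum_surj_acyclic C : C \in components e -> bipartite_on e C ->
  edge_sum_surj -> acyclic_on e C.
Proof.
move=> Cc /(bipartite_sgn Cc)[s [s_sq s_alt]] surj.
case=> [|x [|y [|z p]]] //= /andP[+ Uc].
rewrite /cycle /= => /and3P[/and3P[xC yC xy] /and3P[_ zC yz] zp].
have [u uE] := surj (fun S => (S == [set x; y])%:R).
have f_edge v w : v \in C -> e v w -> [set v; w] != [set x; y] ->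
    s v * u v = s w * u w.
  move=> vC vw vwN; have /eqP := uE v w vw.
  rewrite (negPf vwN) addr_eq0 => /eqP->.
  by rewrite (s_alt v w) // mulNr mulrN.
(* The rest of the cycle, from [z] back to [x], misses [y] and hence never uses the edge [x y]. *)
have yNzx : y \notin z :: rcons p x.
  by move: Uc; rewrite /= !inE mem_rcons !inE => /and3P[/norP[]];
     rewrite eq_sym => /negPf-> _ /norP[/negPf-> /negPf->].
have f_path v q : y \notin v :: q -> path (induced e C) v q ->
    s v * u v = s (last v q) * u (last v q).
  elim: q v => //= w q IHq v; rewrite !inE !negb_or => /and3P[yv yw yq].
  move=> /andP[/and3P[vC wC vw] wq]; rewrite -IHq ?inE ?negb_or ?yw //.
  apply: f_edge => //; apply/eqP => /setP/(_ y).
  by rewrite !inE eqxx orbT (negPf yv) (negPf yw).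
(* Going round the cycle gives [s y * u y = s x * u x], so [u x = - u y], whereas [u x + u y] should
   be 1. *)
have := f_path _ _ yNzx zp; rewrite last_rcons -(f_edge y) //; last first.
  apply/eqP => /setP/(_ x); rewrite !inE eqxx /=.
  by move: Uc => /=; rewrite !inE => /and3P[/norP[/negPf-> /norP[/negPf->]]].
rewrite (s_alt x y) // mulNr => /(congr1 (fun t => s x * t)).
rewrite mulrN !mulrA s_sq !mul1r => uyE.
by have /eqP := uE x y xy; rewrite eqxx -uyE addNr eq_sym oner_eq0.
Qed.

(* Deleting a bridge [a b] of a bipartite component splits off the side of [b];
   the sign function restricted to that side sums to 0 along all other edges. *)
Lemma acyclic_indicator C a b :
    C \in components e -> bipartite_on e C -> acyclic_on e C ->
    a \in C -> e a b ->
  exists u, forall v w, e v w -> u v + u w = ([set v; w] == [set a; b])%:R.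
Proof.
move=> Cc /(bipartite_sgn Cc)[s [s_sq s_alt]] Cac aC ab.
have bC : b \in C by rewrite -(components_edge e_sym Cc ab).
have := acyclic_bridge e_sym e_irr Cc Cac aC ab.
set e' := [rel _ _ | _] => aNb.
have e'_sym : connect_sym e'.
  by apply: sym_connect_sym => v w; rewrite /= e_sym setUC.
have sub_e' : subrel (connect e') (connect e).
  by apply: connect_sub => v w /andP[vw _]; apply: connect1.
(* The factor [s b] normalizes the value at [b] to 1; the value at [a] is 0. *)
exists (fun v => if connect e' b v then s b * s v else 0) => v w vw.
have [vwE|vwN] := eqVneq.
  have ba : connect e' b a = false by rewrite e'_sym; apply: negbTE.
  have vNw : v != w by apply: contraTneq vw => ->; rewrite e_irr.
  have: v \in [set a; b] by rewrite -vwE set21.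
  have: w \in [set a; b] by rewrite -vwE set22.
  rewrite !inE => /orP[]/eqP wE /orP[]/eqP vE; move: vNw;
    by rewrite vE wE ?eqxx // ?ba connect0 s_sq ?addr0 ?add0r.
have vw' : connect e' v w by apply: connect1; rewrite /= vw.
rewrite -(same_connect_r e'_sym vw'); case: ifP => [bv|]; last by rewrite addr0.
rewrite (s_alt v w) ?mulrN ?subrr //.
by rewrite -(components_closed e_sym Cc (sub_e' _ _ bv)).
Qed.

(** A solution on [C] is extended by 0; the remaining edges have both ends outside [C]. *)
Lemma row_full_indicator C a b :
    C \in components e -> row_full (incidence C) -> a \in C -> e a b ->
  exists u, forall v w, e v w -> u v + u w = ([set v; w] == [set a; b])%:R.
Proof.
move=> Cc full aC ab.
have bC : b \in C by rewrite -(components_edge e_sym Cc ab).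
have abE : [set a; b] \in edges_in e C by apply/edges_inP => //; exists a, b.
have /submxP[r] := submx_full (delta_mx 0 (enum_rank_in abE [set a; b])
   : 'rV_#|edges_in e C|) full.
have [u u0 ->] := row_extend r => rE; exists u => v w vw.
have := components_edge e_sym Cc vw; have [vC|vC] := boolP (v \in C) => wC.
  have vwE : [set v; w] \in edges_in e C by apply/edges_inP => //; exists v, w.
  rewrite -(mul_incidence u (j := enum_rank_in vwE [set v; w]) vC _ vw) //;
    last by rewrite enum_rankK_in.
  by rewrite -rE mxE eqxx /= -(inj_eq enum_val_inj) !enum_rankK_in.
rewrite !u0 -?wC // addr0; case: eqP => // vwE.
have: v \in [set a; b] by rewrite -vwE set21.
by rewrite !inE => /orP[]/eqP vE; rewrite vE ?aC ?bC in vC.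
Qed.

Lemma edge_sum_surjP :
  edge_sum_surj <->
  forall C, C \in components e ->
    (bipartite_on e C -> tree_on e C) /\
    (~~ bipartite_on e C -> #|edges_in e C| = #|C|).
Proof.
split=> [surj C Cc|tree y].
  split=> [bip|nbip].
    split; first exact: component_connected.
    exact: edge_sum_surj_acyclic.
  (* The matrix has both full column rank and full row rank, hence is square. *)
  rewrite -(eqP (edge_sum_surj_row_full Cc surj)).
  exact/eqP/nonbipartite_row_free.
have ind (p : T * T) : exists u, e p.1 p.2 -> forall v w, e v w ->
    u v + u w = ([set v; w] == [set p.1; p.2])%:R.
  case: p => a b /=; have [ab|_] := boolP (e a b); last by exists (fun=> 0).
  suff [u uE] : exists u, forall v w, e v w ->
    u v + u w = ([set v; w] == [set a; b])%:R by exists u.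
  have [C Cc aC] := mem_component e a; have [Ctree Csq] := tree C Cc.
  have [bip|nbip] := boolP (bipartite_on e C).
    by have [_ Cac] := Ctree bip; apply: acyclic_indicator aC ab.
  apply: (row_full_indicator Cc _ aC ab).
  by rewrite /row_full (eqP (nonbipartite_row_free Cc nbip)) Csq.
(* Sets that are not edges get the zero function, so that a solution can be chosen for every [S] and
   the results combined with weights [y S]. *)
have {}ind (S : {set T}) : exists u, forall v w, e v w ->
    u v + u w = ([set v; w] == S)%:R.
  have [[p pE ->]|SN] := pselect (exists2 p, e p.1 p.2 & S = [set p.1; p.2]).
    by have [u uE] := ind p; exists u; apply: uE.
  exists (fun=> 0) => v w vw; rewrite addr0; case: eqP => // vwS.
  by case: SN; exists (v, w).
have [U UE] := choice ind.
exists (fun v => \sum_S y S * U S v) => v w vw.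
rewrite -big_split /= (bigD1 [set v; w]) //= -mulrDr UE // eqxx mulr1.
rewrite big1 ?addr0 // => S SN.
by rewrite -mulrDr UE // eq_sym (negPf SN) mulr0.
Qed.

End Incidence.

(** * Points where a polynomial does not vanish, in characteristic 0 *)

Section PolynomialPoints.
Context (k : fieldType) (n : nat).
Hypothesis char0 : [pchar k] =i pred0.

Lemma poly_neq0_point (p : {poly k}) : p != 0 -> exists t, p.[t] != 0.
Proof.
move=> p_neq0; apply: contrapT => /forallNP p0; case/eqP: p_neq0.
(* The images of [0, ..., size p - 1] are distinct in characteristic 0, which is too many roots. *)
apply: (@roots_geq_poly_eq0 _ _ [seq i%:R | i <- iota 0 (size p)]).
- by apply/allP => t _; apply/negPn/negP/p0.
- rewrite map_inj_uniq ?iota_uniq //.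
  have natr_eq0 := (pcharf0P k).1 char0.
  suff le_inj i j : (i <= j)%N -> i%:R = j%:R :> k -> i = j.
    by move=> i j ij; case/orP: (leq_total i j) => /le_inj le;
       [exact: le | exact/esym/le].
  move=> le_ij /eqP; rewrite eq_sym -subr_eq0 -natrB // natr_eq0 subn_eq0 => le_ji.
  by apply/eqP; rewrite eqn_leq le_ij.
- by rewrite size_map size_iota.
Qed.

(* The line through a point where [p] is nonzero and the point (1,...,1). *)
Lemma meval_neq0_torus (p : {mpoly k[n]}) (a : 'I_n -> k) : p.@[a] != 0 ->
  exists2 b : 'I_n -> k, p.@[b] != 0 & forall i, b i != 0.
Proof.
move=> pa; pose h i : {poly k} := (a i)%:P + 'X * (1 - a i)%:P.
have hE t i : (h i).[t] = a i + t * (1 - a i) by rewrite !hornerE.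
have mmap_h t : (mmap polyC h p).[t] = p.@[fun i => (h i).[t]].
  rewrite /meval /mmap horner_sum; apply: eq_bigr => m _.
  rewrite hornerM hornerC /mmap1 horner_prod; congr (_ * _).
  by apply: eq_bigr => i _; rewrite horner_exp.
have nz_h i : h i != 0.
  apply/eqP => /(congr1 (fun q => q.[1])); rewrite hE horner0 mul1r addrC subrK.
  by move/eqP; rewrite oner_eq0.
have nz_p : mmap polyC h p != 0.
  apply: contraNneq pa => /(congr1 (fun q => q.[0])); rewrite mmap_h horner0 => <-.
  by apply/eqP/meval_eq => i; rewrite hE mul0r addr0.
(* Along the line, [p] is nonzero at parameter 0 and each coordinate [h i] is 1 at parameter 1, so
   the product is a nonzero polynomial. *)
have [|t] := @poly_neq0_point (mmap polyC h p * \prod_i h i).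
  by rewrite mulf_neq0 //; apply/prodf_neq0 => i _.
rewrite hornerM horner_prod mulf_eq0 negb_or mmap_h => /andP[pt /prodf_neq0 ht].
by exists (fun i => (h i).[t]) => // i; apply: ht.
Qed.

End PolynomialPoints.

(** * Multiplication by a linear form from degree 1 to degree 2 *)

Section LowDegrees.
Context (k : fieldType) (n : nat) (D : scomplex n).
Implicit Types (a b c : 'I_n -> k) (s : {set 'I_n}) (v w : vertex D).

Local Notation lform a := (\sum_i a i *: 'X_i : {mpoly k[n]}).

Lemma mdeg_sqfree s : mdeg (sqfree s) = #|s|.
Proof.
rewrite mdegE -sum1_card [RHS]big_mkcond; apply: eq_bigr => i _.
by rewrite mnmE; case: (_ \in _).
Qed.

Lemma sqfree1 (i : 'I_n) : sqfree [set i] = U_(i)%MM.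
Proof. by apply/mnmP => j; rewrite mnmE mnm1E inE eq_sym. Qed.

Lemma sqfree2 (i j : 'I_n) : i != j -> sqfree [set i; j] = (U_(i) + U_(j))%MM.
Proof.
move=> ij; apply/mnmP => l; rewrite mnmE mnmDE !mnm1E !inE !(eq_sym l).
by case: (i =P l) ij => [->|//]; rewrite eq_sym => /negPf->.
Qed.

Lemma mcoeff_lform a i : (lform a)@_(U_(i)) = a i.
Proof.
rewrite raddf_sum /= (bigD1 i) //= big1 => [|j ji].
  by rewrite addr0 mcoeffZ mcoeffXU eqxx mulr1.
by rewrite mcoeffZ mcoeffXU (negPf ji) mulr0.
Qed.

Lemma lform_homog a : lform a \is 1.-homog.
Proof. by apply: rpred_sum => i _; rewrite rpredZ // dhomogX /= mdeg1. Qed.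

Lemma mcoeff_lformM a c i j : i != j ->
  (lform a * lform c)@_(U_(i) + U_(j)) = a i * c j + a j * c i.
Proof.
move=> ij; have ji : j != i by rewrite eq_sym.
have coefXM l (p : {mpoly k[n]}) :
    ('X_l * p)@_(U_(i) + U_(j)) =
    if l == i then p@_U_(j) else if l == j then p@_U_(i) else 0.
  have [->|li] := eqVneq l i; first by rewrite mulrC mcoeffMX.
  have [->|lj] := eqVneq l j; first by rewrite mulrC addmC mcoeffMX.
  rewrite mcoeffM big1 // => -[m1 m2] /= /eqP/mnmP/(_ l).
  rewrite !mnmDE !mnm1E !(eq_sym _ l) (negPf li) (negPf lj) mcoeffX.
  by case: eqP => [<-|_]; rewrite ?mul0r // mnm1E eqxx.
have qE := mcoeff_lform c; move: (lform c) qE => q qE.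
rewrite mulr_suml raddf_sum /= (bigD1 i) //= (bigD1 j) //=.
rewrite big1 => [|l /andP[li lj]].
  by rewrite addr0 -!scalerAl !mcoeffZ !coefXM !eqxx (negPf ji) !qE.
by rewrite -scalerAl mcoeffZ coefXM (negPf li) (negPf lj) mulr0.
Qed.

(** Only square-free face monomials survive in the quotient, and by homogeneity only those of degree
    [d] can occur. *)
Lemma piA_homog_eq d (p q : {mpoly k[n]}) : p \is d.-homog -> q \is d.-homog ->
  piA D p = piA D q <->
  {in faces D, forall s, #|s| = d -> p@_(sqfree s) = q@_(sqfree s)}.
Proof.
move=> p_d q_d; rewrite piA_eq A_idealP; split=> eq_pq s sD.
  by move=> _; apply/eqP; rewrite -subr_eq0 -mcoeffB eq_pq.
rewrite mcoeffB; have [/(eq_pq s sD)->|s_d] := eqVneq #|s| d; first by rewrite subrr.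
by rewrite (dhomog_nemf_coeff p_d) ?(dhomog_nemf_coeff q_d) ?subrr //= mdeg_sqfree.
Qed.

Lemma linear_form_eq a c : linear_form D a = linear_form D c <->
  forall v, a (val v) = c (val v).
Proof.
rewrite /linear_form (piA_homog_eq (lform_homog a) (lform_homog c)).
split=> [ac v|ac s sD /eqP/cards1P[i sE]].
  by have := ac [set val v] (valP v) (cards1 _); rewrite sqfree1 !mcoeff_lform.
by rewrite sE in sD *; rewrite sqfree1 !mcoeff_lform (ac (Sub i sD)).
Qed.

(** The two-element faces are exactly the edges: closure under subsets makes their endpoints
    vertices. *)
Lemma mul_linear_form_eq a c q : q \is 2.-homog ->
  linear_form D a * linear_form D c = piA D q <->
  forall v w, skel1 D v w ->
    a (val v) * c (val w) + a (val w) * c (val v)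
    = q@_(sqfree [set val v; val w]).
Proof.
move=> q2; rewrite /linear_form -rmorphM (@piA_homog_eq 2) //; last first.
  exact: dhomogM (lform_homog a) (lform_homog c).
split=> [acq v w /andP[vw vwD]|acq s sD /eqP/cards2P[i [j [ij sE]]]].
  by rewrite -acq ?cards2 ?vw // sqfree2 // mcoeff_lformM.
rewrite sE in sD *.
have iD : [set i] \in faces D by apply: faces_closed sD; rewrite sub1set set21.
have jD : [set j] \in faces D by apply: faces_closed sD; rewrite sub1set set22.
have := acq (Sub i iD) (Sub j jD); rewrite /skel1 /= ij => <- //.
by rewrite sqfree2 // mcoeff_lformM.
Qed.

Lemma eq_mul_linear_form a b c :
  linear_form D a * linear_form D b = linear_form D a * linear_form D c <->
  forall v w, skel1 D v w ->
    a (val v) * b (val w) + a (val w) * b (val v)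
    = a (val v) * c (val w) + a (val w) * c (val v).
Proof.
have q2 : lform a * lform c \is 2.-homog.
  exact: dhomogM (lform_homog a) (lform_homog c).
have -> : linear_form D a * linear_form D c = piA D (lform a * lform c).
  by rewrite rmorphM.
rewrite (mul_linear_form_eq a b q2).
by split=> abc v w /[dup] vw /andP[vNw _]; move: (abc v w vw);
  rewrite sqfree2 // mcoeff_lformM.
Qed.

Lemma A_deg1P (u : SRA k D) :
  reflect (exists a, u = linear_form D a) (u \in A_deg k D 1).
Proof.
apply: (iffP (A_degP _ _)) => [[p p1 ->]|[a ->]]; last first.
  by exists (lform a); first exact: lform_homog.
exists (fun i => p@_U_(i)); apply/(piA_homog_eq p1 (lform_homog _)) => s sD.
by move=> /eqP/cards1P[i ->]; rewrite sqfree1 mcoeff_lform.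
Qed.

Definition extend0 (u : vertex D -> k) (i : 'I_n) : k := oapp u 0 (insub i).

Lemma extend0_val u v : extend0 u (val v) = u v.
Proof. by rewrite /extend0 valK. Qed.

(* The substitution [c v = a v * u v] reduces multiplication by the linear form
   of [a] to multiplication by the sum of the variables. *)
Lemma mul_linear_form_inj a : (forall v, a (val v) != 0) ->
  {in A_deg k D 1 &, injective (fun u => linear_form D a * u)} <->
  edge_sum_inj k (skel1 D).
Proof.
move=> a_neq0; split=> [inj u u_sum v|inj].
  pose c := extend0 (fun v => a (val v) * u v).
  have: linear_form D c = linear_form D (fun=> 0).
    apply: inj; [by apply/A_deg1P; exists c | by apply/A_deg1P; eexists |].
    apply/eq_mul_linear_form => x y xy; rewrite /c !extend0_val !mulr0 addr0.
    transitivity (a (val x) * a (val y) * (u x + u y)); first by ring.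
    by rewrite u_sum // mulr0.
  move=> /linear_form_eq/(_ v)/eqP; rewrite /c extend0_val mulf_eq0.
  by rewrite (negPf (a_neq0 v)) => /eqP.
move=> _ _ /A_deg1P[c ->] /A_deg1P[d ->] /=.
move=> /eq_mul_linear_form eq_cd.
apply/linear_form_eq => v.
suff /(_ v)/eqP : forall v, (c (val v) - d (val v)) / a (val v) = 0.
  by rewrite mulf_eq0 invr_eq0 (negPf (a_neq0 v)) orbF subr_eq0 => /eqP.
apply: inj => {}v w vw.
apply: (mulfI (mulf_neq0 (a_neq0 v) (a_neq0 w))); rewrite mulr0.
transitivity (a (val v) * c (val w) + a (val w) * c (val v)
  - (a (val v) * d (val w) + a (val w) * d (val v))).
  by field; rewrite !a_neq0.
by rewrite eq_cd // subrr.
Qed.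

(** The substitution [c v = a v * u v] is used again, the target value on an edge [v w] being scaled
    by [a v * a w]. *)
Lemma mul_linear_form_surj a : (forall v, a (val v) != 0) ->
  (forall x, x \in A_deg k D 2 ->
     exists2 u, u \in A_deg k D 1 & x = linear_form D a * u) <->
  edge_sum_surj k (skel1 D).
Proof.
move=> a_neq0; split=> [surj y|surj x /A_degP[q q2 ->]].
  (* Pairs that are not edges contribute monomials that vanish in the quotient. *)
  pose q : {mpoly k[n]} := \sum_(S : {set vertex D} | #|S| == 2)
    (y S * \prod_(v in S) a (val v)) *: 'X_[sqfree (val @: S)].
  have q2 : q \is 2.-homog.
    apply: rpred_sum => S /eqP S2.
    by rewrite rpredZ // dhomogX /= mdeg_sqfree card_imset ?S2 //; apply: val_inj.
  have [|_ /A_deg1P[c ->] /esym/(mul_linear_form_eq _ _ q2) cE] := surj (piA D q).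
    by apply/A_degP; exists q.
  exists (fun v => c (val v) / a (val v)) => v w /[dup] vw /andP[vNw _].
  apply: (mulfI (mulf_neq0 (a_neq0 v) (a_neq0 w))).
  transitivity (a (val v) * c (val w) + a (val w) * c (val v)).
    by field; rewrite !a_neq0.
  have vNw' : v != w by rewrite -(inj_eq val_inj).
  rewrite cE // raddf_sum /= (bigD1 [set v; w]) ?cards2 ?vNw' //=.
  rewrite [X in _ + X]big1; last first.
    move=> S /andP[_ SN]; rewrite mcoeffZ mcoeffX.
    case: eqP => [/sqfree_inj SE|_]; last by rewrite mulr0.
    case/eqP: SN; apply: (imset_inj val_inj).
    by rewrite SE imsetU !imset_set1.
  rewrite imsetU !imset_set1 mcoeffZ mcoeffX eqxx mulr1 addr0 mulrC; congr (_ * _).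
  by rewrite (big_setU1 _) ?inE // big_set1.
have [u uE] := surj (fun S =>
  q@_(sqfree (val @: S)) / \prod_(v in S) a (val v)).
exists (linear_form D (extend0 (fun v => a (val v) * u v))).
  by apply/A_deg1P; eexists.
apply/esym/(mul_linear_form_eq _ _ q2) => v w /[dup] vw /andP[vNw _].
have vNw' : v != w by rewrite -(inj_eq val_inj).
rewrite !extend0_val.
transitivity (a (val v) * a (val w) * (u v + u w)); first by ring.
rewrite uE // imsetU !imset_set1 (big_setU1 _) ?inE // big_set1.
by rewrite mulrC divfK // mulf_neq0.
Qed.

(** The right-hand side is free of [a]: all forms with nonzero coefficients at the vertices behave
    alike. *)
Lemma max_rank_linear_form a : (forall v, a (val v) != 0) ->
  max_rank (linear_form D a) 1 <->
  edge_sum_inj k (skel1 D) \/ edge_sum_surj k (skel1 D).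
Proof.
move=> a_neq0; have inj := mul_linear_form_inj a_neq0.
have surj := mul_linear_form_surj a_neq0.
by split=> -[/inj|/surj]; [left|right|left|right].
Qed.

(** * General linear forms and the torus of nonzero coefficients *)

Lemma prodX_neq0 a :
  ((\prod_i 'X_i : {mpoly k[n]}).@[a] != 0) = [forall i, a i != 0].
Proof.
rewrite rmorph_prod /=; apply/prodf_neq0/forallP => a_neq0 i;
  by move: (a_neq0 i); rewrite mevalXU //; apply.
Qed.

Lemma wlp_torus d :
  (forall a, (forall i, a i != 0) -> max_rank (linear_form D a) d) -> wlp k D d.
Proof.
move=> max; exists (\prod_i 'X_i); split=> [|a].
  by exists (fun=> 1); rewrite prodX_neq0; apply/forallP => i; apply: oner_neq0.
by rewrite prodX_neq0 => /forallP/max.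
Qed.

(** A nonempty basic open set contains a point with all coordinates nonzero, and one such form
    decides for all of them. *)
Lemma wlp1P : [pchar k] =i pred0 ->
  wlp k D 1 <-> edge_sum_inj k (skel1 D) \/ edge_sum_surj k (skel1 D).
Proof.
move=> char0; split=> [[p [[a pa] p_max]]|inj_surj].
  have [b pb b_neq0] := meval_neq0_torus char0 pa.
  by apply/(max_rank_linear_form (a := b)) => //; apply: p_max.
by apply: wlp_torus => a a_neq0; apply/max_rank_linear_form.
Qed.

(** * Dimension counts and passage to higher degrees *)

Section Dimension.
Variable l : SRA k D.

Definition mul_by (u : SRA k D) : SRA k D := l * u.

Lemma mul_by_is_linear : linear mul_by.
Proof. by move=> t u w; rewrite /mul_by mulrDr scalerAr. Qed.

HB.instance Definition _ :=
  GRing.isLinear.Build k (SRA k D) (SRA k D) *:%R mul_by mul_by_is_linear.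

Lemma mul_A_deg d : l \in A_deg k D 1 ->
  (linfun mul_by @: A_deg k D d <= A_deg k D d.+1)%VS.
Proof.
move=> /A_degP[p p1 lE]; apply/subvP => _ /memv_imgP[_ /A_degP[q qd ->] ->].
rewrite lfunE /= /mul_by lE -rmorphM; apply/A_degP; exists (p * q) => //.
exact: dhomogM p1 qd.
Qed.

Lemma mul_inj_dim d : l \in A_deg k D 1 ->
  {in A_deg k D d &, injective (fun u => l * u)} ->
  (\dim (A_deg k D d) <= \dim (A_deg k D d.+1))%N.
Proof.
move=> l1 inj; rewrite -(limg_dim_eq (f := linfun mul_by)) ?dimvS ?mul_A_deg //.
apply/eqP; rewrite -subv0; apply/subvP => u.
rewrite memv_cap memv_ker lfunE /= => /andP[ud /eqP lu0]; rewrite memv0.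
by apply/eqP/inj; rewrite ?mem0v // mulr0.
Qed.

(** Rank-nullity: the image is all of degree [d.+1], so the dimension bound leaves a zero kernel. *)
Lemma mul_surj_inj d : l \in A_deg k D 1 ->
  (\dim (A_deg k D d) <= \dim (A_deg k D d.+1))%N ->
  (forall x, x \in A_deg k D d.+1 ->
     exists2 u, u \in A_deg k D d & x = l * u) ->
  {in A_deg k D d &, injective (fun u => l * u)}.
Proof.
move=> l1 le_dim surj u w ud wd /= luw.
have img : (linfun mul_by @: A_deg k D d)%VS = A_deg k D d.+1.
  apply/eqP; rewrite eqEsubv mul_A_deg //=; apply/subvP => x /surj[z zd ->].
  by apply/memv_imgP; exists z; rewrite ?lfunE.
have := limg_ker_dim (linfun mul_by) (A_deg k D d); rewrite img => dimE.
have /eqP : \dim (A_deg k D d :&: lker (linfun mul_by)) == 0%N.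
  by rewrite -leqn0 -(leq_add2r (\dim (A_deg k D d.+1))) dimE.
move=> /eqP; rewrite dimv_eq0 => /eqP ker0.
apply/eqP; rewrite -subr_eq0 -memv0 -ker0 memv_cap rpredB //= memv_ker lfunE /=.
by rewrite /mul_by mulrBr luw subrr.
Qed.

(* [A] is generated in degree 1, so surjectivity propagates upwards. *)
Lemma mul_surjS d :
  (forall x, x \in A_deg k D d.+1 ->
     exists2 u, u \in A_deg k D d & x = l * u) ->
  forall x, x \in A_deg k D d.+2 ->
    exists2 u, u \in A_deg k D d.+1 & x = l * u.
Proof.
move=> surj; suff sub : (A_deg k D d.+2 <= linfun mul_by @: A_deg k D d.+1)%VS.
  by move=> x /(subvP sub)/memv_imgP[u ud ->]; exists u; rewrite ?lfunE.
apply/subv_sumP => m /eqP m_d; rewrite -memvE.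
have [i mi] : exists i, (0 < val m i)%N.
  apply/existsP; apply: contraTT isT; rewrite negb_exists => /forallP m0.
  by move: m_d; rewrite mdegE big1 // => i _; apply/eqP; rewrite -leqn0 leqNgt m0.
have le_m : (U_(i) <= val m)%MM.
  by apply/mnm_lepP => j; rewrite mnm1E; case: eqP => // <-.
have Xm : 'X_[val m] = 'X_i * 'X_[val m - U_(i)] :> {mpoly k[n]}.
  by rewrite -mpolyXD addmC submK.
(* Dividing the monomial by ['X_i] lands in degree [d.+1]; multiplying the preimage found there by
   ['X_i] gives one of the monomial. *)
have [|u /A_degP[p p_d ->] Xu] := surj (piA D 'X_[val m - U_(i)]).
  apply/A_degP; exists 'X_[val m - U_(i)] => //.
  by rewrite dhomogX /= -(eqn_add2r 1) -{1}(mdeg1 i) -mdegD submK // m_d addn1.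
apply/memv_imgP; exists (piA D ('X_i * p)).
  apply/A_degP; exists ('X_i * p) => //; rewrite -[d.+1]add1n.
  by apply: dhomogM p_d; rewrite dhomogX /= mdeg1.
by rewrite lfunE /= /mul_by Xm !rmorphM /= Xu mulrCA.
Qed.

End Dimension.

Lemma linear_form_A_deg1 a : linear_form D a \in A_deg k D 1.
Proof. by apply/A_deg1P; exists a. Qed.

(** Degree 0 consists of constants, and [t] is recovered from the coefficient [a v * t] at the
    vertex [v]. *)
Lemma mul_linear_form_inj0 a v : a (val v) != 0 ->
  {in A_deg k D 0 &, injective (fun u => linear_form D a * u)}.
Proof.
move=> av_neq0 _ _ /A_degP[p p0 ->] /A_degP[q q0 ->] /=.
have const (r : {mpoly k[n]}) : r \is 0.-homog -> r = (r@_0%MM)%:MP.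
  move=> r0; apply/mpolyP => m; rewrite mcoeffC; case: eqP => [->|/eqP m0].
    by rewrite mulr1.
  by rewrite mulr0 (dhomog_nemf_coeff r0) //= mdeg_eq0.
rewrite (const p p0) (const q q0) /linear_form -!rmorphM /=.
have mulC t : lform a * t%:MP = lform (fun i => a i * t).
  rewrite mulrC mul_mpolyC scaler_sumr; apply: eq_bigr => i _.
  by rewrite scalerA mulrC.
rewrite !mulC => /linear_form_eq/(_ v)/(mulfI av_neq0)->.
by [].
Qed.

Lemma wlp_all_degrees : [pchar k] =i pred0 ->
  (\dim (A_deg k D 2) < \dim (A_deg k D 1))%N -> wlp k D 1 ->
  forall d, wlp k D d.
Proof.
move=> char0 lt_dim /(wlp1P char0) inj_surj d; apply: wlp_torus => a a_neq0.
have av_neq0 v : a (val v) != 0 by apply: a_neq0.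
have not_inj : ~ {in A_deg k D 1 &, injective (fun u => linear_form D a * u)}.
  move=> inj; have := mul_inj_dim (linear_form_A_deg1 a) inj.
  by rewrite leqNgt lt_dim.
have surj : edge_sum_surj k (skel1 D).
  by case: inj_surj => // /(mul_linear_form_inj av_neq0).
case: d => [|d].
  (* Without vertices, injectivity in degree 1 would hold vacuously, against [not_inj]. *)
  left; have [v _|v0] := pickP (@predT (vertex D)).
    exact: mul_linear_form_inj0 (av_neq0 v).
  case: not_inj; apply/mul_linear_form_inj => // u _ v.
  by have := v0 v.
right; elim: d => [|d IHd]; last exact: mul_surjS.
exact/(mul_linear_form_surj av_neq0).
Qed.

End LowDegrees.

(** The dimensions select the alternative of maximal rank: in the first case surjectivity forces
    injectivity, in the second injectivity is impossible. *)
Theorem theorem1p1 (k : fieldType) (n : nat) (D : scomplex n)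
    (n_gt0 : (0 < n)%N) (char0 : [pchar k] =i pred0) :
  ((\dim (A_deg k D 1) <= \dim (A_deg k D 2))%N ->
     (wlp k D 1 <->
        forall C, C \in components (skel1 D) -> ~~ bipartite_on (skel1 D) C))
  /\
  ((\dim (A_deg k D 2) < \dim (A_deg k D 1))%N ->
     (wlp k D 1 <->
        forall C, C \in components (skel1 D) ->
          (bipartite_on (skel1 D) C -> tree_on (skel1 D) C) /\
          (~~ bipartite_on (skel1 D) C -> #|edges_in (skel1 D) C| = #|C|))
     /\ (wlp k D 1 -> forall d : nat, wlp k D d)).
Proof.
have two_neq0 : 2%:R != 0 :> k by rewrite ((pcharf0P k).1 char0).
have injP := edge_sum_injP (@skel1_sym n D) two_neq0.
have surjP := edge_sum_surjP (@skel1_sym n D) (@skel1_irr n D) two_neq0.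
(* The sum of the variables is the test form carrying the dimension arguments over to edge sums. *)
have one_neq0 (v : vertex D) : (fun=> 1 : k) (val v) != 0 by apply: oner_neq0.
have l1 := linear_form_A_deg1 D (fun=> 1 : k).
have inj1 := mul_linear_form_inj (a := fun=> 1) one_neq0.
have surj1 := mul_linear_form_surj (a := fun=> 1) one_neq0.
split=> [le_dim|lt_dim].
  rewrite -injP (wlp1P D char0); split=> [[//|surj]|]; last by left.
  by apply/inj1/mul_surj_inj => //; apply/surj1.
split; last exact: wlp_all_degrees.
rewrite -surjP (wlp1P D char0); split=> [[inj|//]|]; last by right.
have := mul_inj_dim l1 (inj1.2 inj).
by rewrite leqNgt lt_dim.
Qed.
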